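(* Assume that the bounded bilinear form $b:Y\times V\to\mathbb{R}$ satisfies the following: there is a constant $C_b>0$ with $$C_b\|y\|_Y\le \sup_{0\ne v\in V}\frac{b(y,v)}{\|v\|_V}\quad\forall y\in Y,\qquad\text{and}\qquad \{v\in V: b(y,v)=0\ \text{for all } y\in Y\}=\{0\}.$$ Assume also that $\Pi:V\to V_h$ is a Fortin operator. Then the discrete optimal control problem $$\min\{J(\mathsf y_h,\mathsf u_h):(\mathsf y_h,\mathsf u_h)\in Y_h\times U_{ad,h}\}\quad\text{subject to}\quad b(\mathsf y_h,v_h)=\langle D\mathsf u_h,v_h\rangle_{V',V}\ \ \forall v_h\in V_h^{\Theta_h}$$ admits a unique solution $(\bar{\mathsf y}_h,\bar{\mathsf u}_h)\in Y_h\times U_{ad,h}$.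
   Context: $U,Y,V,\mathcal Y$ are real Hilbert spaces; $U_{ad}\subseteq U$ is non-empty, bounded, closed and convex; $b:Y\times V\to\mathbb{R}$ is a bounded bilinear form; $O:Y\to\mathcal Y$ and $D:U\to V'$ are bounded linear operators; $\mathsf y_d\in\mathcal Y$ and $\alpha>0$ are given. The cost functional is $$J(\mathsf y,\mathsf u):=\tfrac12\|O\mathsf y-\mathsf y_d\|_{\mathcal Y}^2+\tfrac{\alpha}{2}\|\mathsf u\|_U^2 .$$ $V_h\subseteq V$ and $Y_h\subseteq Y$ are finite-dimensional subspaces, and $U_h\subseteq U$ is a (not necessarily discrete) subspace with $U_{ad,h}:=U_h\cap U_{ad}\neq\emptyset$; the choice $U_h=U$ is allowed. The discrete trial-to-test operator $\Theta_h:Y\to V_h$ is defined by $(\Theta_h\mathsf y,v_h)_V=b(\mathsf y,v_h)$ for all $v_h\in V_h$, and $V_h^{\Theta_h}:=\Theta_h(Y_h)$. A map $\Pi:V\to V_h$ is a Fortin operator if there is $C_\Pi>0$ such that $\|\Pi v\|_V\le C_\Pi\|v\|_V$ and $b(\mathsf y_h,v-\Pi v)=0$ for all $\mathsf y_h\in Y_h$ and $v\in V$.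
   Formalization: The subspace U_h of U is assumed to be closed (this includes U_h = U and finite-dimensional U_h); for a dense non-closed U_h the minimum over U_h ∩ U_ad need not be attained, so existence can fail. *)

(* Defs.v *)
From HB Require Import structures.
From mathcomp Require Import all_boot all_order all_algebra.
From mathcomp Require Import all_classical all_reals all_analysis.
Set Implicit Arguments.
Unset Strict Implicit.
Unset Printing Implicit Defensive.
Import Order.TTheory GRing.Theory Num.Theory.
Import numFieldNormedType.Exports.
Local Open Scope classical_set_scope.
Local Open Scope ring_scope.

HB.mixin Record CompleteNormedModule_isHilbert (R : realType) (V : Type)
    & CompleteNormedModule R V := {
  inner : {dot V for (@idfun R)} ;
  inner_norm : forall v : V, inner v v = `|v| ^+ 2
}.

#[short(type="hilbertType")]
HB.structure Definition Hilbert (R : realType) :=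
  {V of CompleteNormedModule R V & CompleteNormedModule_isHilbert R V}.

Section dual.
Variables (R : realType) (V : normedModType R).

Definition continuous_functional : {pred (V -> R^o)} :=
  fun f => `[< linear f /\ continuous f >].

Lemma continuous_functional_submod : submod_closed continuous_functional.
Proof.
split; rewrite ?unfold_in.
  apply/asboolP; split; last exact: cst_continuous.
  by move=> a u v; rewrite scaler0 addr0.
move=> a f g; rewrite !unfold_in => /asboolP[lf cf] /asboolP[lg cg].
apply/asboolP; split.
  move=> k u v; rewrite !fctE lf lg !scalerDr addrACA !scalerA.
  by rewrite [a * k]mulrC.
by move=> x; apply: cvgD; [apply: cvgZl_tmp; exact: cf|exact: cg].
Qed.

HB.instance Definition _ := GRing.isSubmodClosed.Build R (V -> R^o)
  continuous_functional continuous_functional_submod.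

(* the topological dual of V *)
Record dual := Dual {
  dual_fun :> V -> R^o ;
  dual_funP : dual_fun \in continuous_functional }.

HB.instance Definition _ := [isSub of dual for dual_fun].
HB.instance Definition _ := [Choice of dual by <:].
HB.instance Definition _ := [SubChoice_isSubLmodule of dual by <:].

Lemma dual_linear (f : dual) : linear f.
Proof. by have := dual_funP f; rewrite unfold_in => /asboolP[]. Qed.

Lemma dual_continuous (f : dual) : continuous f.
Proof. by have := dual_funP f; rewrite unfold_in => /asboolP[]. Qed.

HB.instance Definition _ (f : dual) :=
  GRing.isLinear.Build R V R^o *:%R (dual_fun f) (dual_linear f).

Definition dual_norm (f : dual) : R :=
  sup [set `|f v| | v in [set v | `|v| <= 1]].

Lemma dual_has_sup (f : dual) : has_sup [set `|f v| | v in [set v | `|v| <= 1]].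
Proof.
split; first by exists `|f 0|, 0; rewrite //= normr0.
have /linear_bounded_continuous/linear_boundedP := @dual_continuous f.
move=> /pinfty_ex_gt0[M M0 fM]; exists M => _ [v /= v1 <-].
by rewrite (le_trans (fM v))// ler_piMr// ltW.
Qed.

Lemma dual_norm_ub (f : dual) v : `|v| <= 1 -> `|f v| <= dual_norm f.
Proof. by move=> v1; apply: ub_le_sup; [case: (dual_has_sup f)|exists v]. Qed.

Lemma dual_norm_le (f : dual) M :
  (forall v, `|v| <= 1 -> `|f v| <= M) -> dual_norm f <= M.
Proof.
move=> fM; apply: ge_sup; first by case: (dual_has_sup f).
by move=> _ [v /= v1 <-]; exact: fM.
Qed.

Lemma dual_normD (f g : dual) : dual_norm (f + g) <= dual_norm f + dual_norm g.
Proof.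
apply: dual_norm_le => v v1; rewrite (le_trans (ler_normD _ _))//.
by rewrite lerD ?dual_norm_ub.
Qed.

Lemma dual_normZ (a : R) (f : dual) : dual_norm (a *: f) = `|a| * dual_norm f.
Proof.
have le b h : dual_norm (b *: h) <= `|b| * dual_norm h.
  apply: dual_norm_le => v v1; rewrite [leLHS]normrM.
  by rewrite ler_wpM2l// dual_norm_ub.
apply/eqP; rewrite eq_le le /=; have [->|a0] := eqVneq a 0.
  rewrite normr0 mul0r (le_trans (normr_ge0 ((0 *: f : dual) 0)))//.
  by rewrite dual_norm_ub// normr0.
rewrite -ler_pdivlMl ?normr_gt0// -normfV.
by have := le a^-1 (a *: f); rewrite scalerA mulVf// scale1r.
Qed.

Lemma dual_norm0_eq0 (f : dual) : dual_norm f = 0 -> f = 0.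
Proof.
move=> f0; apply/val_inj/funext => v /=; have [->|v0] := eqVneq v 0.
  by rewrite linear0.
have /(dual_norm_ub f) : `|(`|v|^-1 *: v)| <= 1.
  by rewrite normrZ normfV normr_id mulVf ?normr_eq0.
rewrite f0 linearZ /= normrZ normfV normr_id.
by rewrite pmulr_rle0 ?invr_gt0 ?normr_gt0// normr_le0 => /eqP.
Qed.

HB.instance Definition _ := Lmodule_isNormed.Build R dual
  dual_normD dual_normZ dual_norm0_eq0.

End dual.


Section definitions.
Variable R : realType.

Definition bounded_operator (E F : normedModType R) (f : E -> F) :=
  exists M : R, forall x, `|f x| <= M * `|x|.

Definition bounded_form (E F : normedModType R) (f : E -> F -> R) :=
  exists M : R, forall x y, `|f x y| <= M * `|x| * `|y|.

(* As usual in Hilbert spaces, a subspace that is not assumed to be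
   finite-dimensional is a closed linear subspace. *)
Definition closed_subspace (E : normedModType R) (A : set E) :=
  submod_closed [in A] /\ closed A.

Definition finite_dim_subspace (E : lmodType R) (A : set E) :=
  exists n (e : 'I_n -> E), A = [set \sum_(i < n) c i *: e i | c in [set: 'I_n -> R]].

Definition trial_to_test (Y : normedModType R) (V : hilbertType R)
    (b : Y -> V -> R) (Vh : set V) (Theta : Y -> V) :=
  forall y, Vh (Theta y) /\ forall v, Vh v -> inner (Theta y) v = b y v.

(* Fortin operators are not assumed to be linear. *)
Definition Fortin_operator (Y V : normedModType R)
    (b : Y -> V -> R) (Yh : set Y) (Vh : set V) (Pi : V -> V) :=
  [/\ forall v, Vh (Pi v),
      exists2 C : R, 0 < C & forall v, `|Pi v| <= C * `|v|
    & forall y v, Yh y -> b y (v - Pi v) = 0].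

Definition cost (Y Z U : normedModType R) (O : Y -> Z) (yd : Z) (alpha : R)
    (p : Y * U) : R :=
  2^-1 * `|O p.1 - yd| ^+ 2 + alpha / 2 * `|p.2| ^+ 2.

Definition admissible_pairs (Y V U : normedModType R) (b : Y -> V -> R)
    (D : U -> dual V) (Yh : set Y) (Uadh : set U) (Vtest : set V) : set (Y * U) :=
  [set p | [/\ Yh p.1, Uadh p.2 & forall v, Vtest v -> b p.1 v = D p.2 v]].

Definition minimizer (T : Type) (J : T -> R) (S : set T) (p : T) :=
  S p /\ forall q, S q -> J p <= J q.

End definitions.

(* Main.v *)
(* Restricted to Yh, the form (y, z) |-> b(y, Theta z) = (Theta y, Theta z) is a
   Gram form, so every control u has a discrete state.  The Fortin operator and
   the inf-sup condition give Cb |y| <= C_Pi |Theta y| on Yh, and testing with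
   Theta y itself bounds |Theta y| by |D u|; hence differences of feasible
   states are controlled by differences of their controls.  The parallelogram
   identity makes the controls of a minimizing sequence Cauchy, so the states
   converge along with them, and the limit is feasible because the set of
   admissible controls is closed. *)
Require Import Defs.
From HB Require Import structures.
From mathcomp Require Import all_boot all_order all_algebra.
From mathcomp Require Import all_classical all_reals all_analysis.
From mathcomp Require Import ring lra.
Import Order.TTheory GRing.Theory Num.Theory.
Import numFieldNormedType.Exports.
Local Open Scope classical_set_scope.
Local Open Scope ring_scope.

(** * Inner product estimates and Riesz representation on a finite span *)

Section hilbert.
Context {R : realType} {V : hilbertType R}.
Implicit Types u v : V.

Lemma innerC u v : inner u v = inner v u.
Proof. by rewrite hermC expr0 mul1r. Qed.

Lemma normD_sqr u v : `|u + v| ^+ 2 = `|u| ^+ 2 + `|v| ^+ 2 + 2 * inner u v.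
Proof.
rewrite -!inner_norm linearDl /= !linearDr /= [inner v u]innerC.
by ring.
Qed.

Lemma normB_sqr u v : `|u - v| ^+ 2 = `|u| ^+ 2 + `|v| ^+ 2 - 2 * inner u v.
Proof. by rewrite normD_sqr normrN linearNr mulrN. Qed.

(** Expanding the squared norm of [|v| u - |u| v] gives [2 |u| |v| (|u| |v| - inner u v)], which is
    therefore nonnegative. *)
Lemma inner_le_norm u v : inner u v <= `|u| * `|v|.
Proof.
have [->|u0] := eqVneq u 0; first by rewrite linear0l normr0 mul0r.
have [->|v0] := eqVneq v 0; first by rewrite linear0r normr0 mulr0.
have := sqr_ge0 `| `|v| *: u - `|u| *: v |.
rewrite normB_sqr !normrZ !normr_id.
rewrite [inner (_ *: _) _]linearZl_LR /= [inner _ (_ *: _)]linearZr_LR /=.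
have uv0 : 0 < `|u| * `|v| by rewrite mulr_gt0// normr_gt0.
rewrite (_ : _ - _ = 2 * (`|u| * `|v|) * (`|u| * `|v| - inner u v)); last by ring.
by rewrite pmulr_rge0 ?subr_ge0// mulr_gt0.
Qed.

Lemma norm_midpoint_sqr u v :
  `|2^-1 *: (u + v)| ^+ 2 = 2^-1 * (`|u| ^+ 2 + `|v| ^+ 2) - 4^-1 * `|u - v| ^+ 2.
Proof.
by rewrite normrZ exprMn (normB_sqr u) (normD_sqr u) ger0_norm ?invr_ge0//; field.
Qed.

(* The right-hand side [l (e j)] is orthogonal to the kernel of the Gram matrix
   of [e], because a combination of the [e j] with coefficients in that kernel
   has norm [0]; no linear independence of [e] is needed. *)
Lemma finite_Riesz n (e : 'I_n -> V) (l : {linear V -> R^o}) :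
  exists c : 'I_n -> R, forall j, inner (\sum_(i < n) c i *: e i) (e j) = l (e j).
Proof.
pose G : 'M[R]_n := \matrix_(i, j) inner (e i) (e j).
pose f : 'rV[R]_n := \row_j l (e j).
(* [f] lies in the row space of [G] exactly when it annihilates the cokernel of [G]; a row [c] with
   [f = c *m G] then holds the coefficients. *)
have : (f <= G)%MS.
  rewrite submxE; move: (cokermx G) (mulmx_coker G) => K GK0.
  apply/eqP/rowP => k; rewrite !mxE.
  pose d := \sum_j K j k *: e j.
  have ed0 i : inner (e i) d = 0.
    have := congr1 (fun M : 'M[R]_n => M i k) GK0; rewrite !mxE => <-.
    rewrite linear_sumr; apply: eq_bigr => j _.
    by rewrite linearZr_LR /= mxE mulrC.
  have d0 : d = 0.
    apply/eqP; rewrite -normr_eq0 -sqrf_eq0 -inner_norm {1}/d.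
    by rewrite linear_sumlz big1// => i _; rewrite linearZl_LR /= ed0 mulr0.
  transitivity (l d); last by rewrite d0 linear0.
  rewrite linear_sum; apply: eq_bigr => j _.
  by rewrite linearZ /= mxE mulrC.
move=> /submxP[c fc]; exists (c 0) => j.
have := congr1 (fun M : 'rV[R]_n => M 0 j) fc; rewrite !mxE => ->.
by rewrite linear_sumlz; apply: eq_bigr => i _; rewrite linearZl_LR /= mxE.
Qed.

End hilbert.

(** * Norms of functionals, finite spans and a convergence criterion *)

Lemma dual_le {R : realType} {V : normedModType R} (f : dual V) v :
  `|f v| <= `|f| * `|v|.
Proof.
have [->|v0] := eqVneq v 0; first by rewrite linear0 !normr0 mulr0.
rewrite -ler_pdivrMr ?normr_gt0//.
have := @dual_norm_ub _ _ f (`|v|^-1 *: v).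
rewrite normrZ normfV normr_id mulVf ?normr_eq0// => /(_ (lexx _)).
by rewrite linearZ normrZ normfV normr_id mulrC.
Qed.

Lemma finite_dim_subspace_lincomb {R : realType} {E : lmodType R} (A : set E) a x y :
  finite_dim_subspace A -> A x -> A y -> A (a *: x + y).
Proof.
move=> [n [e ->]] [c _ <-] [d _ <-]; exists (fun i => a * c i + d i) => //.
rewrite scaler_sumr -big_split; apply: eq_bigr => i _ /=.
by rewrite scalerDl scalerA.
Qed.

Lemma dist_le_cvg {R : realType} {E F : normedModType R} (C : R)
    (x_ : nat -> E) (x : E) (y_ : nat -> F) (y : F) :
  (forall n, `|y - y_ n| <= C * `|x - x_ n|) ->
  x_ n @[n --> \oo] --> x -> y_ n @[n --> \oo] --> y.
Proof.
move=> yx cx; apply/cvgrPdist_le => e e0.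
(* [C] may be zero or negative, so [|C| + 1] takes its place as a divisor. *)
have C1 : 0 < `|C| + 1 by rewrite ltr_wpDl.
move/cvgrPdist_le/(_ _ (divr_gt0 e0 C1)) : cx => xe.
near=> n; apply: le_trans (yx n) _.
have : `|x - x_ n| <= e / (`|C| + 1) by near: n.
rewrite ler_pdivlMr// mulrC; apply: le_trans; rewrite ler_wpM2r//.
by rewrite (le_trans (ler_norm _))// lerDl.
Unshelve. all: by end_near.
Qed.

(** * Strong convexity in the control and the direct method *)

Section cost.
Context {R : realType} {U Y Z : hilbertType R}.
Variables (O : {linear Y -> Z}) (yd : Z) (alpha : R).
Hypotheses (O_bounded : bounded_operator O) (alpha_gt0 : 0 < alpha).
Local Notation J := (cost O yd alpha).

Lemma cost_ge0 (p : Y * U) : 0 <= J p.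
Proof. by rewrite addr_ge0// mulr_ge0// ?divr_ge0// ltW. Qed.

(** By the parallelogram identity the control term gains [alpha / 2 * 4^-1 = alpha / 8]. The
    observation term only leaves a nonnegative remainder [d / 8], which is dropped. *)
Lemma cost_midpoint (p q : Y * U) :
  J (2^-1 *: (p + q)) + alpha / 8 * `|p.2 - q.2| ^+ 2 <= (J p + J q) / 2.
Proof.
have mid : O (2^-1 *: (p.1 + q.1)) - yd = 2^-1 *: ((O p.1 - yd) + (O q.1 - yd)).
  rewrite linearZ linearD /= addrACA -opprD scalerBr; congr (_ - _).
  by rewrite -mulr2n -[yd *+ 2]scaler_nat scalerA mulVf ?scale1r.
rewrite /cost /= mid !norm_midpoint_sqr.
have := sqr_ge0 `|O p.1 - yd - (O q.1 - yd)|.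
move: (`|O p.1 - yd - (O q.1 - yd)| ^+ 2) => d d0.
rewrite -subr_ge0 (_ : _ - _ = d / 8); first by rewrite divr_ge0.
by field.
Qed.

(** Serves twice: it makes the controls of a minimizing sequence Cauchy, and the controls of two
    minimizers equal. *)
Lemma minimizer_gap (K : set (Y * U)) (m : R) (p q : Y * U) :
  (forall p q, K p -> K q -> K (2^-1 *: (p + q))) ->
  (forall p, K p -> m <= J p) -> K p -> K q ->
  alpha / 8 * `|p.2 - q.2| ^+ 2 <= (J p - m + (J q - m)) / 2.
Proof.
move=> Kmid Km Kp Kq; have := cost_midpoint p q.
by have := Km _ (Kmid _ _ Kp Kq); lra.
Qed.

(** Closedness is asked of the set of controls: a limit control comes with some state in [K], and
    the Lipschitz bound forces the states of the sequence to converge to that state. The same bound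
    reduces uniqueness to the controls. *)
Lemma minimizer_unique_exists (K : set (Y * U)) (C : R) :
  K !=set0 ->
  (forall p q, K p -> K q -> K (2^-1 *: (p + q))) ->
  (forall p q, K p -> K q -> `|p.1 - q.1| <= C * `|p.2 - q.2|) ->
  closed (snd @` K) ->
  exists! p, minimizer J K p.
Proof.
move=> [p0 Kp0] Kmid KC Kcl.
pose m := inf (J @` K).
have Jinf : has_inf (J @` K).
  by split; [exists (J p0), p0|exists 0 => _ [p _ <-]; exact: cost_ge0].
have Km p : K p -> m <= J p by move=> Kp; apply: ge_inf; [case: Jinf|exists p].
pose x n : R := n.+1%:R^-1.
have x0 n : 0 < x n by rewrite invr_gt0.
(* With this rate, minimizer_gap yields |u_N - u_n| < 1 / (N + 1) for N <= n. *)
have /choice[p_ p_P] n : exists p, K p /\ J p < m + alpha / 8 * x n ^+ 2.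
  have e0 : 0 < alpha / 8 * x n ^+ 2 by rewrite mulr_gt0 ?divr_gt0 ?exprn_gt0.
  by have [_ [p Kp <-] ?] := inf_adherent e0 Jinf; exists p.
have Kp_ n : K (p_ n) by case: (p_P n).
have Jp_ n : J (p_ n) < m + alpha / 8 * x n ^+ 2 by case: (p_P n).
have dist N n : (N <= n)%N -> `|(p_ N).2 - (p_ n).2| < x N.
  move=> Nn; rewrite -(@ltr_pXn2r _ 2)// ?nnegrE// ?(ltW (x0 _))//.
  have xx : x n ^+ 2 <= x N ^+ 2.
    by rewrite ler_sqr ?nnegrE ?(ltW (x0 _))// lef_pV2 ?posrE// ler_nat ltnS.
  have := minimizer_gap _ _ _ _ Kmid Km (Kp_ N) (Kp_ n).
  have a8 : 0 < alpha / 8 by rewrite divr_gt0.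
  have := Jp_ N; have := Jp_ n; move: (alpha / 8) a8 => a a0.
  move=> JN Jn gap; rewrite -(ltr_pM2l a0).
  by have := ler_wpM2l (ltW a0) xx; lra.
have x_cvg : x n @[n --> \oo] --> (0 : R) by exact: cvg_harmonic.
have u_cvg : cvg ((p_ n).2 @[n --> \oo]).
  apply: cauchy_cvg; apply: cauchy_exP => e e0.
  have /cvgrPdist_lt/(_ _ e0)[N _ xN] := x_cvg.
  exists (p_ N).2; exists N => // n /= Nn.
  rewrite -ball_normE /=; apply: (lt_trans (dist N n Nn)).
  by have /= := xN N (leqnn N); rewrite sub0r normrN gtr0_norm.
have [p Kp pE] : (snd @` K) (lim ((p_ n).2 @[n --> \oo])).
  apply: (closed_cvg (snd @` K) Kcl _ _ u_cvg).
  by apply: nearW => n; exists (p_ n).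
move: u_cvg; rewrite -pE => u_cvg.
have y_cvg := dist_le_cvg _ _ _ _ _ (fun n => KC p (p_ n) Kp (Kp_ n)) u_cvg.
have [M OM] := O_bounded.
have Oy_cvg : O (p_ n).1 @[n --> \oo] --> O p.1.
  by apply: dist_le_cvg y_cvg => n; rewrite -linearB; exact: OM.
have J_cvg : J (p_ n) @[n --> \oo] --> J p.
  have sqr_cvg (f : nat -> R) (a : R) : f n @[n --> \oo] --> a ->
      f n ^+ 2 @[n --> \oo] --> a ^+ 2 by move=> fa; exact: (cvgM fa fa).
  apply: cvgD; apply: cvgMl_tmp; apply: sqr_cvg; apply: cvg_norm => //.
  by apply: cvgB => //; exact: cvg_cst.
have Jpm : J p <= m.
  have b_cvg : m + alpha / 8 * x n ^+ 2 @[n --> \oo] --> m + alpha / 8 * 0 ^+ 2.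
    by apply: cvgD; [exact: cvg_cst|apply: cvgMl_tmp; exact: cvgM].
  rewrite expr0n mulr0 addr0 in b_cvg.
  by apply: (ler_cvg_to J_cvg b_cvg); apply: nearW => n; exact: ltW.
exists p; split; first by split=> // q Kq; apply: le_trans (Km _ Kq).
move=> q [Kq qmin].
(* Both costs are at most [m], so the upper bound in [minimizer_gap] is nonpositive. *)
have pq2 : `|p.2 - q.2| = 0.
  apply/eqP; rewrite -sqrf_eq0 eq_le sqr_ge0 andbT.
  have a8 : 0 < alpha / 8 by rewrite divr_gt0.
  rewrite -(pmulr_rle0 _ a8).
  by have := minimizer_gap _ _ _ _ Kmid Km Kp Kq; have := qmin _ Kp; lra.
have pq1 : `|p.1 - q.1| <= 0 by have := KC _ _ Kp Kq; rewrite pq2 mulr0.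
move: pq1 pq2; rewrite normr_le0 => /eqP/subr0_eq pq1 /normr0_eq0/subr0_eq pq2.
by rewrite (surjective_pairing p) pq1 pq2 -surjective_pairing.
Qed.

End cost.

(** * Solvability and stability of the discrete state equation *)

Section discrete_state.
Context {R : realType} {Y V : hilbertType R}.
Variables (b : {bilinear Y -> V -> R^o}) (Yh : set Y) (Vh : set V).
Variable Theta : Y -> V.
Hypotheses (Yh_subspace : finite_dim_subspace Yh)
  (Vh_subspace : finite_dim_subspace Vh)
  (Theta_def : trial_to_test b Vh Theta).

(** The linearity defect [d] lies in [Vh] and is orthogonal to [Vh], hence to itself. *)
Lemma trial_to_test_linear : linear Theta.
Proof.
move=> a y z; pose d := Theta (a *: y + z) - (a *: Theta y + Theta z).
have Vd : Vh d.
  rewrite /d addrC -scaleN1r; apply: finite_dim_subspace_lincomb => //.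
    by apply: finite_dim_subspace_lincomb => //; apply: (Theta_def _).1.
  exact: (Theta_def _).1.
apply/subr0_eq/eqP; rewrite -/d -normr_eq0 -sqrf_eq0 -inner_norm.
rewrite {1}/d linearBl linearPl /= !(Theta_def _).2//.
by rewrite linearPl subrr.
Qed.

Lemma discrete_state_exists (l : {linear V -> R^o}) :
  exists2 y, Yh y & forall v, (Theta @` Yh) v -> b y v = l v.
Proof.
have [n [e YhE]] := Yh_subspace.
have Theta_sum (c : 'I_n -> R) :
    Theta (\sum_i c i *: e i) = \sum_i c i *: Theta (e i).
  pose T := GRing.isLinear.Build R Y V *:%R Theta trial_to_test_linear.
  pose L : {linear Y -> V} := HB.pack Theta T.
  by rewrite -[LHS]/(L _) linear_sum; apply: eq_bigr => i _; rewrite linearZ.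
(* The Riesz coefficients for the family [Theta (e i)], applied to the [e i] themselves, give the
   state. *)
have [c cP] := finite_Riesz _ (Theta \o e) l.
exists (\sum_i c i *: e i); first by rewrite YhE; exists c.
move=> _ [z + <-]; rewrite {1}YhE => -[d _ <-].
rewrite -(Theta_def _).2; last exact: (Theta_def _).1.
rewrite !Theta_sum linear_sumr linear_sum; apply: eq_bigr => j _.
by rewrite linearZr_LR linearZ /= -cP.
Qed.

(** The functional [l] is arbitrary so that the bound also applies to a difference of two states. *)
Lemma discrete_state_stable (Pi : V -> V) :
  (exists2 Cb : R, 0 < Cb &
    forall y, Cb * `|y| <= sup [set b y v / `|v| | v in [set v | v != 0]]) ->
  Fortin_operator b Yh Vh Pi ->
  exists2 C : R, 0 <= C & forall y (l : dual V), Yh y ->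
    (forall v, (Theta @` Yh) v -> b y v = l v) -> `|y| <= C * `|l|.
Proof.
move=> [Cb Cb0 infsup] [PiV [CP CP0 PiC] Pib].
exists (CP / Cb) => [|y l Yy yl]; first by rewrite divr_ge0// ltW.
have Tl : `|Theta y| <= `|l|.
  have [->|T0] := eqVneq (Theta y) 0; first by rewrite normr0.
  rewrite -(@ler_pM2r _ `|Theta y|) ?normr_gt0// -expr2 -inner_norm.
  have [VT ->//] := Theta_def y; rewrite yl; last by exists y.
  exact: le_trans (ler_norm _) (dual_le _ _).
rewrite mulrAC ler_pdivlMr// mulrC (le_trans (infsup y))//.
(* If [V] is trivial there are no quotients, and the supremum of the empty set is [0] by
   convention. *)
have [->|/set0P ne0] := eqVneq [set b y v / `|v| | v in [set v | v != 0]] set0.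
  by rewrite sup0 mulr_ge0// ltW.
apply: ge_sup => // _ [v v0 <-].
rewrite ler_pdivrMr ?normr_gt0//.
(* The Fortin property replaces [v] by [Pi v], which lies in [Vh], where [Theta y] represents
   [b y]. *)
have -> : b y v = inner (Theta y) (Pi v).
  rewrite (Theta_def _).2//; apply/subr0_eq.
  by rewrite -linearBr Pib.
apply: le_trans (inner_le_norm _ _) _.
by rewrite mulrAC mulrC ler_pM//.
Qed.

End discrete_state.

Theorem theorem4p3 (R : realType) (U Y V Z : hilbertType R)
  (Uad : set U) (b : {bilinear Y -> V -> R^o})
  (O : {linear Y -> Z}) (D : {linear U -> dual V})
  (yd : Z) (alpha : R)
  (Yh : set Y) (Vh : set V) (Uh : set U)
  (Theta : Y -> V) (Pi : V -> V)
  (Uad_neq0 : Uad !=set0) (Uad_bounded : bounded_set Uad)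
  (Uad_closed : closed Uad)
  (Uad_convex : convex_set (Uad : set (convex_lmodType U)))
  (b_bounded : bounded_form b)
  (O_bounded : bounded_operator O) (D_bounded : bounded_operator D)
  (alpha_gt0 : 0 < alpha)
  (Yh_subspace : finite_dim_subspace Yh)
  (Vh_subspace : finite_dim_subspace Vh)
  (Uh_subspace : closed_subspace Uh)
  (Uadh_neq0 : Uh `&` Uad !=set0)
  (Theta_def : trial_to_test b Vh Theta)
  (b_infsup : exists2 Cb : R, 0 < Cb &
    forall y, Cb * `|y| <= sup [set b y v / `|v| | v in [set v | v != 0]])
  (b_nondegenerate : [set v | forall y, b y v = 0] = [set 0])
  (Pi_Fortin : Fortin_operator b Yh Vh Pi) :
  exists! p : Y * U,
    minimizer (cost O yd alpha)
      (admissible_pairs b D Yh (Uh `&` Uad) (Theta @` Yh)) p.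
Proof.
have [C C0 stable] := discrete_state_stable _ _ _ _ Theta_def _ b_infsup Pi_Fortin.
have [M DM] := D_bounded.
have YhP a x y : Yh x -> Yh y -> Yh (a *: x + y).
  exact: finite_dim_subspace_lincomb.
(* The Lipschitz constant is the stability constant [C] times the bound [M] of [D]. *)
apply: (minimizer_unique_exists _ _ _ O_bounded alpha_gt0 _ (C * M)).
- have [u Uu] := Uadh_neq0.
  have [y Yy yu] := discrete_state_exists _ _ _ _ Yh_subspace Vh_subspace Theta_def (D u).
  by exists (y, u).
- move=> p q [Yp Up bp] [Yq Uq bq]; split => /=.
  (* [YhP] only handles [a *: x + y], so a zero summand is added and obtained as [p.1 - p.1]. *)
  + rewrite -[_ *: _]addr0; apply: (YhP); last first.
      by rewrite -(subrr p.1) addrC -scaleN1r; exact: YhP.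
    by rewrite -[p.1]scale1r; exact: YhP.
  + split.
      have [[Uh0 UhP] _] := Uh_subspace; apply/set_mem.
      rewrite -[_ *: _]addr0; apply: (UhP) => //.
      rewrite -[p.2]scale1r; apply: (UhP); apply/mem_set.
        by case: Up.
      by case: Uq.
    have h0 : 0 <= (2^-1 : R) by [].
    have h1 : (2^-1 : R) <= 1 by rewrite invf_le1 ?ler1n.
    have := @Uad_convex p.2 q.2 (Itv01 h0 h1) (mem_set Up.2) (mem_set Uq.2).
    move=> /set_mem; congr Uad; rewrite scalerDr; congr (_ + _ *: _).
    by rewrite -[LHS]/(1 - 2^-1); field.
  + move=> v Vv; rewrite linearZl_LR linearDl /= bp// bq//.
    by rewrite [D (_ *: _)]linearZ [D (_ + _)]linearD.
(* By linearity, the difference of the states solves the state equation for the difference of the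
   controls. *)
- move=> p q [Yp _ bp] [Yq _ bq]; rewrite -mulrA.
  apply: (@le_trans _ _ (C * `|D (p.2 - q.2)|)); last by rewrite ler_wpM2l.
  apply: stable; first by rewrite addrC -scaleN1r; exact: YhP.
  by move=> v Vv; rewrite linearBl bp// bq// [D (_ - _)]linearB.
(* Since every control has a discrete state, the projection onto the controls loses none of [Uh] and
   [Uad]'s intersection. *)
- suff -> : snd @` admissible_pairs b D Yh (Uh `&` Uad) (Theta @` Yh) = Uh `&` Uad.
    by apply: closedI => //; case: Uh_subspace.
  apply/seteqP; split=> [_ [p [_ Up _] <-]//|u Uu].
  have [y Yy yu] := discrete_state_exists _ _ _ _ Yh_subspace Vh_subspace Theta_def (D u).
  by exists (y, u).
Qed.
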